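(* Let $\Bbbk$ be a field, $n \geq 1$ and $d \geq 2$. The algebra $NC_A(n,d)$ is a Frobenius algebra if and only if $n = 1$ or $d = 2$.
   Context: $NC_A(n,d)$ is the $\Bbbk$-algebra generated by $T_1,\dots,T_n$ with relations $T_iT_{i+1}T_i = T_{i+1}T_iT_{i+1}$ for $0<i<n$, $T_iT_j = T_jT_i$ for $|i-j|>1$, $T_1^2 = \cdots = T_{n-1}^2 = 0$, and $T_n^d = 0$. A finite-dimensional algebra $A$ is Frobenius if it admits a nondegenerate bilinear form $\sigma$ with $\sigma(ab,c) = \sigma(a,bc)$ for all $a,b,c$. *)

(* Defs.v *)
From HB Require Import structures.
From mathcomp Require Import all_boot all_order all_algebra.
Set Implicit Arguments. Unset Strict Implicit. Unset Printing Implicit Defensive.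
Import GRing.Theory.
Local Open Scope ring_scope.

(* The algebra NC_A(n,d) is realised as the quotient of the free associative
   k-algebra k<t_0,...,t_{n-1}> by the two-sided ideal generated by the
   defining relations.  Generator t_i (i : 'I_n) stands for the paper's
   T_{i+1}.  Elements of the free algebra are represented by formal finite
   linear combinations of words (lists of (coefficient, word) pairs); two such
   lists denote the same noncommutative polynomial iff they have the same
   coefficient at every word. *)

Definition word (n : nat) := seq 'I_n.
Definition ncpoly (F : fieldType) (n : nat) := seq (F * word n).

Section FreeAlg.
Variables (F : fieldType) (n : nat).

Definition nccoef (p : ncpoly F n) (w : word n) : F :=
  \sum_(x <- p | x.2 == w) x.1.

Definition ncadd (p q : ncpoly F n) : ncpoly F n := p ++ q.
Definition ncscale (c : F) (p : ncpoly F n) : ncpoly F n :=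
  [seq (c * x.1, x.2) | x <- p].
Definition ncsub (p q : ncpoly F n) : ncpoly F n := ncadd p (ncscale (-1) q).
Definition ncmul (p q : ncpoly F n) : ncpoly F n :=
  [seq (x.1 * y.1, x.2 ++ y.2) | x <- p, y <- q].
Definition ncword (w : word n) : ncpoly F n := [:: (1, w)].

Definition NCA_rel (d : nat) (r : ncpoly F n) : Prop :=
  exists i j : 'I_n,
    [\/ (val i).+1 = val j /\
          r = [:: (1, [:: i; j; i]); (-1, [:: j; i; j])],
        ((val i).+1 < val j)%N /\ r = [:: (1, [:: i; j]); (-1, [:: j; i])],
        ((val i).+1 < n)%N /\ r = [:: (1, [:: i; i])]
      | (val i).+1 = n /\ r = [:: (1, nseq d i)]].

Inductive NCA_ideal (d : nat) : ncpoly F n -> Prop :=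
  | NCAI_rel r u v : NCA_rel d r ->
      NCA_ideal d (ncmul (ncword u) (ncmul r (ncword v)))
  | NCAI_add p q : NCA_ideal d p -> NCA_ideal d q -> NCA_ideal d (ncadd p q)
  | NCAI_scale c p : NCA_ideal d p -> NCA_ideal d (ncscale c p)
  | NCAI_zero p : (forall w, nccoef p w = 0) -> NCA_ideal d p
  | NCAI_ext p q : NCA_ideal d p -> (forall w, nccoef p w = nccoef q w) ->
      NCA_ideal d q.

Definition ncform (sigma : word n -> word n -> F) (p q : ncpoly F n) : F :=
  \sum_(x <- p) \sum_(y <- q) x.1 * y.1 * sigma x.2 y.2.

Definition NCA_findim (d : nat) : Prop :=
  exists B : seq (word n), forall w : word n,
    exists p : ncpoly F n, all (fun x => x.2 \in B) p /\
      NCA_ideal d (ncsub (ncword w) p).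

(* NC_A(n,d) is Frobenius: it is finite dimensional and carries a
   nondegenerate associative bilinear form.  A bilinear form on the quotient
   A = k<t>/I is the same as a bilinear form on k<t> (determined by its values
   sigma on pairs of words) vanishing whenever one argument lies in I. *)
Definition NCA_Frobenius (d : nat) : Prop :=
  NCA_findim d /\
  exists sigma : word n -> word n -> F,
    [/\
        (forall p q, NCA_ideal d p -> ncform sigma p q = 0 /\ ncform sigma q p = 0),
        (forall a b c, ncform sigma (ncmul a b) c = ncform sigma a (ncmul b c)),
        (forall p, (forall q, ncform sigma p q = 0) -> NCA_ideal d p)
      &
        (forall q, (forall p, ncform sigma p q = 0) -> NCA_ideal d q)].

End FreeAlg.

(* Main.v *)
Require Import Defs.
From HB Require Import structures.
From mathcomp Require Import all_boot all_order all_algebra.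
From mathcomp Require Import zify.
Set Implicit Arguments. Unset Strict Implicit. Unset Printing Implicit Defensive.
Import GRing.Theory.
Local Open Scope ring_scope.

(** All relations equate two words or kill a word, so a partial action of the
    generators on a set X that satisfies them yields, for x, y in X, a linear
    form "u |-> [x.u = y]" vanishing on the ideal.

    For d = 2 the generators act on sequences of integers by swapping an ascent
    at positions i, i+1 and killing a descent.  Products of descending runs
    span the algebra and move (0, ..., n) to pairwise distinct permutations;
    since every permutation can be bubble-sorted to (n, ..., 0), the coefficient
    of the longest element defines a form with a dual basis.  For n = 1 the
    same argument applies to the action k |-> k+1 on {0, ..., d-1}.

    For n >= 2 and d >= 3, the right socle contains both the longest
    element w0 and (longest element of T_1, ..., T_(n-2)) T_n^2 T_(n-1)...T_1.
    Both are nonzero and independent, as two partial actions show, whereas the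
    right socle of a local Frobenius algebra is one-dimensional. *)

(** * Evaluation of functions on words, and calculation modulo the ideal *)

Section Evaluation.
Variables (F : fieldType) (n d : nat).
Implicit Types (p q r : ncpoly F n) (u v w : word n) (g : word n -> F).

(** The linear extension of [g] to the free algebra. Polynomials are compared below through all such
    evaluations, of which the coefficients are special cases. *)
Definition ncev g p : F := \sum_(x <- p) x.1 * g x.2.

Lemma ncevD g p q : ncev g (ncadd p q) = ncev g p + ncev g q.
Proof. exact: big_cat. Qed.

Lemma ncevZ g c p : ncev g (ncscale c p) = c * ncev g p.
Proof.
by rewrite /ncev big_map mulr_sumr; apply: eq_bigr => x _ /=; rewrite mulrA.
Qed.

Lemma ncevB g p q : ncev g (ncsub p q) = ncev g p - ncev g q.
Proof. by rewrite ncevD ncevZ mulN1r. Qed.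

Lemma ncev_word g w : ncev g (ncword F w) = g w.
Proof. by rewrite /ncev big_seq1 mul1r. Qed.

Lemma ncev_nil g : ncev g [::] = 0.
Proof. exact: big_nil. Qed.

Lemma ncev_cons g x p : ncev g (x :: p) = x.1 * g x.2 + ncev g p.
Proof. exact: big_cons. Qed.

Lemma eq_ncev g g' p : g =1 g' -> ncev g p = ncev g' p.
Proof. by move=> gg'; apply: eq_bigr => x _; rewrite gg'. Qed.

Lemma ncevM g p q :
  ncev g (ncmul p q) = ncev (fun u => ncev (fun v => g (u ++ v)) q) p.
Proof.
rewrite /ncev /ncmul big_allpairs_dep; apply: eq_bigr => x _.
by rewrite mulr_sumr; apply: eq_bigr => y _ /=; rewrite mulrA.
Qed.

Lemma ncform_ncev sigma p q :
  ncform sigma p q = ncev (fun u => ncev (sigma u) q) p.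
Proof.
apply: eq_bigr => x _; rewrite mulr_sumr.
by apply: eq_bigr => y _; rewrite mulrA.
Qed.

Lemma nccoef_ncev p w : nccoef p w = ncev (fun u => (u == w)%:R) p.
Proof.
rewrite /nccoef big_mkcond; apply: eq_bigr => x _ /=.
by case: eqP => _; rewrite ?mulr1 ?mulr0.
Qed.

(** Makes evaluation independent of the list chosen to represent a polynomial, as it expresses the
    value through coefficients alone. *)
Lemma ncev_nccoef g p (S : seq (word n)) :
  uniq S -> {subset [seq x.2 | x <- p] <= S} ->
  ncev g p = \sum_(w <- S) nccoef p w * g w.
Proof.
move=> uS sub; under eq_bigr => w _ do rewrite /nccoef big_mkcond mulr_suml.
rewrite exchange_big /=; apply: eq_big_seq => x xp.
have xS : x.2 \in S by apply: sub; apply: map_f.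
rewrite (bigD1_seq x.2) //= eqxx big1 ?addr0 // => w.
by rewrite eq_sym => /negPf->; rewrite mul0r.
Qed.

Lemma ncev_eqcoef g p q :
  (forall w, nccoef p w = nccoef q w) -> ncev g p = ncev g q.
Proof.
move=> e; pose S := undup [seq x.2 | x <- p ++ q].
rewrite !(@ncev_nccoef g _ S) ?undup_uniq //.
- by apply: eq_bigr => w _; rewrite e.
- by move=> w; rewrite mem_undup map_cat mem_cat => ->; rewrite orbT.
- by move=> w; rewrite mem_undup map_cat mem_cat => ->.
Qed.

Notation I := (@NCA_ideal F n d).

Lemma ideal_ext p q : (forall g, ncev g p = ncev g q) -> I p -> I q.
Proof. by move=> e /NCAI_ext; apply=> w; rewrite !nccoef_ncev. Qed.

Lemma ideal_zero p : (forall g, ncev g p = 0) -> I p.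
Proof. by move=> e; apply: NCAI_zero => w; rewrite nccoef_ncev. Qed.

Lemma ideal_nil : I [::].
Proof. by apply: ideal_zero => g; rewrite ncev_nil. Qed.

Lemma ideal_refl p : I (ncsub p p).
Proof. by apply: ideal_zero => g; rewrite ncevB subrr. Qed.

Lemma ideal_sym p q : I (ncsub p q) -> I (ncsub q p).
Proof.
move=> /(NCAI_scale (-1)); apply: ideal_ext => g.
by rewrite ncevZ !ncevB mulN1r opprB.
Qed.

Lemma ideal_trans q p r : I (ncsub p q) -> I (ncsub q r) -> I (ncsub p r).
Proof.
move=> Ipq /(NCAI_add Ipq); apply: ideal_ext => g.
by rewrite ncevD !ncevB addrA subrK.
Qed.

Lemma ideal_eq p q : I (ncsub p q) -> I q -> I p.
Proof.
move=> Ipq /(NCAI_add Ipq); apply: ideal_ext => g.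
by rewrite ncevD !ncevB subrK.
Qed.

Lemma ideal_mulw a b p :
  I p -> I (ncmul (ncword F a) (ncmul p (ncword F b))).
Proof.
have ev g q : ncev g (ncmul (ncword F a) (ncmul q (ncword F b))) =
    ncev (fun u => g (a ++ u ++ b)) q.
  rewrite ncevM ncev_word ncevM; apply: eq_ncev => u.
  by rewrite ncev_word.
elim=> {p} [r u v Rr | p q _ Ip _ Iq | c p _ Ip | p p0 | p q _ Ip e].
- have := NCAI_rel (a ++ u) (v ++ b) Rr; apply: ideal_ext => g.
  rewrite ev !ncevM !ncev_word !ncevM; apply: eq_ncev => w.
  by rewrite !ncev_word -!catA.
- by move: (NCAI_add Ip Iq); apply: ideal_ext => g; rewrite ncevD !ev ncevD.
- by move: (NCAI_scale c Ip); apply: ideal_ext => g; rewrite ncevZ !ev ncevZ.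
- apply: ideal_zero => g; rewrite ev.
  rewrite (@ncev_eqcoef _ _ [::]) ?ncev_nil // => w.
  by rewrite p0 /nccoef big_nil.
- by move: Ip; apply: ideal_ext => g; rewrite !ev; apply: ncev_eqcoef.
Qed.

(** Since each relation kills a word or identifies two words, most of the calculation can be done
    with single words modulo the ideal. *)
Definition zerow u := I (ncword F u).
Definition eqw u v := I (ncsub (ncword F u) (ncword F v)).

Lemma eqw_refl u : eqw u u. Proof. exact: ideal_refl. Qed.
Lemma eqw_sym u v : eqw u v -> eqw v u. Proof. exact: ideal_sym. Qed.
Lemma eqw_trans v u w : eqw u v -> eqw v w -> eqw u w.
Proof. exact: ideal_trans. Qed.
Lemma zerow_eqw u v : eqw u v -> zerow v -> zerow u.
Proof. exact: ideal_eq. Qed.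

Lemma zerow_cat a b u : zerow u -> zerow (a ++ u ++ b).
Proof.
move=> /(ideal_mulw a b); apply: ideal_ext => g.
by rewrite !ncevM !ncev_word ncevM !ncev_word.
Qed.

Lemma eqw_cat a b u v : eqw u v -> eqw (a ++ u ++ b) (a ++ v ++ b).
Proof.
move=> /(ideal_mulw a b); apply: ideal_ext => g.
by rewrite ncevM ncev_word ncevM !ncevB !ncev_word.
Qed.

Lemma NCA_rel_ideal r : NCA_rel d r -> I r.
Proof.
move=> /(NCAI_rel [::] [::]); apply: ideal_ext => g.
rewrite ncevM ncev_word ncevM; apply: eq_ncev => w.
by rewrite ncev_word cats0.
Qed.

(* The two kernels of the Gram matrix of a spanning family both contain the
   relations of the family and have equal rank, so it is enough that one of
   them consists of relations. *)
Lemma Frobenius_left_nondegenerate (sigma : word n -> word n -> F)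
    (B : seq (word n)) :
  (forall u, zerow u \/ exists2 b, b \in B & eqw u b) ->
  (forall p q, I p -> ncform sigma p q = 0 /\ ncform sigma q p = 0) ->
  (forall a b c,
      ncform sigma (ncmul a b) c = ncform sigma a (ncmul b c)) ->
  (forall p, (forall q, ncform sigma p q = 0) -> I p) ->
  NCA_Frobenius F n d.
Proof.
move=> span van assoc left; split.
  exists B => w; case: (span w) => [zw | [b bB wb]].
    by exists [::].
  by exists (ncword F b); rewrite /= bB.
exists sigma; split=> // q q0.
pose N := size B; pose b (i : 'I_N) := nth [::] B i.
pose lin (c : 'rV[F]_N) : ncpoly F n := [seq (c 0 i, b i) | i <- enum 'I_N].
have evl g c : ncev g (lin c) = \sum_i c 0 i * g (b i).
  by rewrite /ncev big_map big_enum.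
have expand p : exists c, I (ncsub p (lin c)).
  elim: p => [|[a u] p [c Ic]].
    exists 0; apply: ideal_zero => g; rewrite ncevB evl ncev_nil sub0r.
    by rewrite big1 ?oppr0 // => i _; rewrite mxE mul0r.
  case: (span u) => [zu | [e eB ue]].
    exists c; move: (NCAI_add (NCAI_scale a zu) Ic); apply: ideal_ext => g.
    by rewrite ncevD ncevZ !ncevB ncev_word ncev_cons addrA.
  have iB : (index e B < N)%N by rewrite index_mem.
  exists (c + a *: delta_mx 0 (Ordinal iB)).
  move: (NCAI_add (NCAI_scale a ue) Ic); apply: ideal_ext => g.
  rewrite ncevD ncevZ !ncevB !ncev_word ncev_cons /= !evl.
  under [in RHS]eq_bigr => i _ do rewrite !mxE mulrDl eqxx /=.
  rewrite big_split /= [X in _ = _ - (_ + X)](bigD1 (Ordinal iB)) //=.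
  rewrite eqxx mulr1 [X in _ = _ - (_ + (_ + X))]big1; last first.
    by move=> i /negPf->; rewrite mulr0 mul0r.
  by rewrite /b /= nth_index // addr0 mulrBr opprD addrACA [- _ - _]addrC.
pose G : 'M[F]_N := \matrix_(i, j) sigma (b i) (b j).
have form_lin c e : ncform sigma (lin c) (lin e) = (c *m G *m e^T) 0 0.
  rewrite ncform_ncev evl mxE.
  under eq_bigr => i _ do rewrite evl mulr_sumr.
  rewrite exchange_big; apply: eq_bigr => j _; rewrite !mxE mulr_suml.
  by apply: eq_bigr => i _; rewrite !mxE [e _ _ * _]mulrC mulrA.
have congl p p' r : I (ncsub p p') -> ncform sigma p r = ncform sigma p' r.
  move=> /(van _ r) [+ _]; rewrite !ncform_ncev ncevB => /eqP.
  by rewrite subr_eq0 => /eqP.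
have congr p p' r : I (ncsub p p') -> ncform sigma r p = ncform sigma r p'.
  move=> /(van _ r) [_ +]; rewrite !ncform_ncev => /eqP.
  rewrite (eq_ncev _ (fun u => ncevB (sigma u) p p')) /ncev.
  under eq_bigr => x _ do rewrite mulrBr.
  by rewrite sumrB subr_eq0 => /eqP.
have kerI (c : 'rV_N) : c *m G = 0 -> I (lin c).
  move=> cG; apply: left => r; have [e Ie] := expand r.
  by rewrite (congr _ _ _ Ie) form_lin cG mul0mx mxE.
have entry0 (c : 'rV_N) : (forall e : 'rV_N, (e *m c^T) 0 0 = 0) -> c = 0.
  move=> c0; apply/rowP => i; rewrite mxE -(c0 (delta_mx 0 i)) -rowE !mxE.
  by [].
(* A vector in the left kernel gives an element of the ideal by [kerI], so it pairs to zero on the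
   other side as well. *)
have sub : (kermx G <= kermx G^T)%MS.
  apply/row_subP => i; apply/sub_kermxP; set c := row i _.
  have cG : c *m G = 0 by rewrite /c -row_mul mulmx_ker row0.
  apply: entry0 => e; rewrite trmx_mul trmxK mulmxA -form_lin.
  by have [] := van _ (lin e) (kerI _ cG).
have [c Ic] := expand q; apply: (ideal_eq Ic); apply: kerI.
apply/sub_kermxP; apply: submx_trans (_ : c <= kermx G^T)%MS _.
  apply/sub_kermxP; apply: entry0 => e.
  by rewrite trmx_mul trmxK mulmxA -form_lin -(congr _ _ _ Ic).
(* [G] and its transpose have equal rank, so the inclusion of their kernels is an equality. *)
by have := mxrank_leqif_sup sub => -[_ <-]; rewrite !mxrank_ker mxrank_tr.
Qed.

End Evaluation.

(** * Partial actions of the generators *)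

Section PartialActions.
Variables (X : eqType) (t : nat -> X -> option X).

(** A right action: the first letter acts first, and [None] plays the role of the zero vector. *)
Fixpoint acts (x : X) (w : seq nat) : option X :=
  if w is i :: w' then obind (acts^~ w') (t i x) else Some x.

Lemma acts_cat x u v : acts x (u ++ v) = obind (acts^~ v) (acts x u).
Proof. by elim: u x => //= i u IH x; case: (t i x) => //=. Qed.

Definition NCA_action (n d : nat) : Prop :=
  [/\ forall i x, (i.+1 < n)%N ->
        acts x [:: i; i.+1; i] = acts x [:: i.+1; i; i.+1],
      forall i j x, (i.+1 < j)%N -> (j < n)%N ->
        acts x [:: i; j] = acts x [:: j; i],
      forall i x, (i.+1 < n)%N -> acts x [:: i; i] = None
    & forall i x, i.+1 = n -> acts x (nseq d i) = None].

Definition injective_action : Prop :=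
  forall i x y z, t i x = Some z -> t i y = Some z -> x = y.

Lemma acts_inj x y z w :
  injective_action -> acts x w = Some z -> acts y w = Some z -> x = y.
Proof.
move=> inj; elim: w x y => [x y /= [->] [->] // | i w IH x y /=].
case Ex: (t i x) => [x'|] //=; case Ey: (t i y) => [y'|] //= ax ay.
by rewrite (IH _ _ ax ay) in Ex; apply: inj Ex Ey.
Qed.

End PartialActions.

(** * Linear forms obtained from an action, and a Frobenius criterion *)

Section ActionIdeal.
Variables (F : fieldType) (n d : nat) (X : eqType) (t : nat -> X -> option X).
Hypothesis tP : NCA_action t n d.

Definition wact (x : X) (u : word n) := acts t x (map val u).

Lemma wact_cat x u v : wact x (u ++ v) = obind (wact^~ v) (wact x u).
Proof. by rewrite /wact map_cat acts_cat. Qed.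

(** The form is the matrix entry at [x], [y] of the representation on the span of [X]; it vanishes
    since the defining relations act by zero. *)
Lemma action_ideal (p : ncpoly F n) x y : NCA_ideal d p ->
  ncev (fun u => (wact x u == Some y)%:R) p = 0.
Proof.
case: tP => braid comm sq pow.
elim=> {p} [r u v [i [j H]] | p q _ Ip _ Iq | c p _ Ip | p p0 | p q _ Ip e].
- rewrite ncevM ncev_word ncevM.
  rewrite (@eq_ncev _ _ _
    (fun w => (obind (fun z => obind (wact^~ v) (wact z w)) (wact x u)
               == Some y)%:R)); last first.
    by move=> w; rewrite ncev_word wact_cat; case: (wact x u) => //= z;
      rewrite wact_cat.
  case: H => -[ij ->]; rewrite !ncev_cons ncev_nil /= ?mulN1r ?mul1r ?addr0.
  + apply/eqP; rewrite subr_eq0; apply/eqP; congr (_ == _)%:R.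
    case: (wact x u) => //= z; congr obind.
    by have := braid (val i) z; rewrite ij; apply; apply: ltn_ord.
  + apply/eqP; rewrite subr_eq0; apply/eqP; congr (_ == _)%:R.
    by case: (wact x u) => //= z; congr obind; apply: comm ij _; apply: ltn_ord.
  + by case: (wact x u) => //= z; rewrite {2}/wact sq.
  + by case: (wact x u) => //= z; rewrite {2}/wact map_nseq pow.
- by rewrite ncevD Ip Iq addr0.
- by rewrite ncevZ Ip mulr0.
- by rewrite (@ncev_eqcoef _ _ _ _ [::]) ?ncev_nil // => w;
    rewrite p0 /nccoef big_nil.
- by rewrite -(ncev_eqcoef _ e).
Qed.

Lemma zerow_wact u x : zerow F d u -> wact x u = None.
Proof.
case E: (wact x u) => [y|] // /(action_ideal x y).
by rewrite ncev_word E eqxx => /eqP; rewrite oner_eq0.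
Qed.

Lemma eqw_wact u v x : eqw F d u v -> wact x u = wact x v.
Proof.
move=> uv; case E: (wact x u) => [y|].
  move/(action_ideal x y)/eqP: uv; rewrite ncevB !ncev_word E eqxx.
  by rewrite subr_eq0; case: (wact x v =P Some y) => //= _; rewrite oner_eq0.
case E': (wact x v) => [y|] //.
move/(action_ideal x y)/eqP: uv; rewrite ncevB !ncev_word E E' eqxx /=.
by rewrite sub0r oppr_eq0 oner_eq0.
Qed.

(* The form is the coefficient of the class acting as x0 |-> top in the
   product; the hypothesis on top provides the dual basis. *)
Lemma action_Frobenius (x0 top : X) (B : seq (word n)) :
  injective_action t ->
  (forall u, zerow F d u \/ exists2 b, b \in B & eqw F d u b) ->
  {in B, forall b, wact x0 b != None} ->
  {in B &, injective (wact x0)} ->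
  {in B, forall b y, wact x0 b = Some y -> exists v, wact y v = Some top} ->
  NCA_Frobenius F n d.
Proof.
move=> inj span Bn0 Binj Btop.
pose g u : F := (wact x0 u == Some top)%:R.
pose sigma (u v : word n) := g (u ++ v).
apply: (@Frobenius_left_nondegenerate F n d sigma B) => //.
- move=> p q Ip; split; rewrite ncform_ncev.
    suff e u : ncev (fun v => sigma v u) p = 0.
      rewrite /ncev; under eq_bigr => x _ do rewrite mulr_sumr.
      rewrite exchange_big big1 // => y _ /=.
      under eq_bigr => x _ do rewrite mulrCA.
      by rewrite -mulr_sumr [X in _ * X](e y.2) mulr0.
    rewrite /sigma /g.
    have := action_ideal x0 top (ideal_mulw [::] u Ip).
    rewrite ncevM ncev_word ncevM => <-; apply: eq_ncev => v.
    by rewrite ncev_word.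
  have e u : ncev (sigma u) p = 0.
    have := action_ideal x0 top (ideal_mulw u [::] Ip).
    rewrite ncevM ncev_word ncevM => <-; apply: eq_ncev => v.
    by rewrite ncev_word cats0.
  by rewrite (eq_ncev _ e) /ncev big1 // => x _; rewrite mulr0.
- move=> a b c; rewrite !ncform_ncev !ncevM; apply: eq_ncev => u.
  rewrite ncevM; apply: eq_ncev => v; apply: eq_ncev => w.
  by rewrite /sigma catA.
move=> p p0.
(* Pairing with a word that moves [y] to [top] detects exactly the words that move [x0] to [y],
   because the action is injective. *)
have {p0} p0 y v : wact y v = Some top ->
    ncev (fun u => (wact x0 u == Some y)%:R) p = 0.
  move=> yv; rewrite -(p0 (ncword F v)) ncform_ncev; apply: eq_ncev => u.
  rewrite ncev_word /sigma /g wact_cat; case: (wact x0 u) => [z|] //=.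
  congr (nat_of_bool _)%:R; apply/eqP/eqP => [[->] // | zv].
  by congr Some; apply: acts_inj zv yv.
(* Outside the ideal, [rep u] is the word of [B] congruent to [u]. For [u] in the ideal the search
   fails and returns the empty word, which the factor [c u] below removes. *)
pose rep u := nth [::] B (find (fun b => wact x0 b == wact x0 u) B).
have repP u : zerow F d u \/ rep u \in B /\ eqw F d u (rep u).
  case: (span u) => [|[b bB ub]]; [by left | right].
  have hasB : has (fun b => wact x0 b == wact x0 u) B.
    by apply/hasP; exists b; rewrite // (eqw_wact _ ub).
  have rB : rep u \in B by rewrite mem_nth -?has_find.
  split=> //; rewrite (_ : rep u = b) //; apply: Binj => //.
  by rewrite (eqP (nth_find [::] hasB)); apply: eqw_wact.
pose c u : F := (wact x0 u != None)%:R.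
pose p' : ncpoly F n := [seq (x.1 * c x.2, rep x.2) | x <- p].
suff Ip' : NCA_ideal d p'.
  apply: (@ideal_eq _ _ _ _ p') => //; rewrite /p'.
  elim: p {p0 p' Ip'} => [|[a u] p IH]; first exact: ideal_nil.
  case: (repP u) => [zu | [rB ur]].
    move: (NCAI_add (NCAI_scale a zu) IH); apply: ideal_ext => h.
    rewrite ncevD ncevZ !ncevB ncev_word !ncev_cons /c /=.
    by rewrite (zerow_wact _ zu) /= mulr0 mul0r add0r addrA.
  move: (NCAI_add (NCAI_scale a ur) IH); apply: ideal_ext => h.
  rewrite ncevD ncevZ !ncevB !ncev_word !ncev_cons /c /=.
  rewrite (eqw_wact _ ur) Bn0 // mulr1 mulrBr opprD.
  by rewrite addrACA.
apply: NCAI_zero => w; rewrite nccoef_ncev {1}/ncev big_map /=.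
have [wB | wB] := boolP (w \in B); last first.
  rewrite big1 // => x _; case: (repP x.2) => [zx | [rB _]].
    by rewrite /c (zerow_wact _ zx) mulr0 mul0r.
  by case: eqP wB => [<- | _ _]; rewrite ?rB ?mulr0.
(* The coefficient of [p'] at [w] collects the words of [p] that move [x0] where [w] does, a sum
   that vanishes by [p0]. *)
have := Bn0 w wB; case E: (wact x0 w) => [y|] // _.
have [v yv] := Btop w wB y E; rewrite -[RHS](p0 y v yv) /ncev.
apply: eq_bigr => x _; rewrite -mulrA; congr (_ * _).
case: (repP x.2) => [zx | [rB xr]].
  by rewrite /c (zerow_wact _ zx) mul0r.
rewrite /c (eqw_wact _ xr) Bn0 // mul1r; congr (nat_of_bool _)%:R.
apply/eqP/eqP => [-> // | e]; apply: Binj => //; by rewrite e E.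
Qed.

End ActionIdeal.

(** * The case n = 1: truncated polynomials *)

Section OneGenerator.
Variables (F : fieldType) (d : nat).
Hypothesis d_gt1 : (1 < d)%N.

(** The point [k] stands for T_1^k, on which the generator acts by multiplication. *)
Let incr (_ k : nat) := if (k.+1 < d)%N then Some k.+1 else None.

(** The empty word is singled out because [k] may be at least [d]. *)
Let acts_incr k w : acts incr k w =
  if (w == [::]) || (k + size w < d)%N then Some (k + size w)%N else None.
Proof.
elim: w k => [|i w IH] k /=; first by rewrite addn0.
rewrite /incr; case: ltnP => /= kd; last by case: ifP => //; lia.
by rewrite -/incr IH addSnnS; case: w {IH} => //=; rewrite addn1 kd.
Qed.

Lemma NCA_1_Frobenius : NCA_Frobenius F 1 d.
Proof.
have wE (u : word 1) : u = nseq (size u) ord0.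
  by apply/all_pred1P/allP => i _; rewrite (ord1 i).
apply: (@action_Frobenius F 1 d nat incr _ 0%N d.-1
          [seq nseq k ord0 | k <- iota 0 d]).
- split=> // i x _.
  by rewrite acts_incr size_nseq; case: d d_gt1 => // d' _; case: ifP => //=; lia.
- by move=> i x y z; rewrite /incr; do 2!case: ifP => // _; case=> <- [].
- move=> u; case: (ltnP (size u) d) => ud.
    right; exists u; last exact: eqw_refl.
    by rewrite [u]wE; apply/mapP; exists (size u); rewrite // mem_iota.
  left; rewrite [u]wE -(subnKC ud) nseqD.
  apply: (@zerow_cat _ _ _ [::]); apply: NCA_rel_ideal.
  by exists ord0, ord0; constructor 4.
- move=> _ /mapP[k + ->]; rewrite mem_iota /= add0n => kd.
  by rewrite /wact acts_incr size_map size_nseq kd orbT.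
- move=> _ _ /mapP[k + ->] /mapP[l + ->]; rewrite !mem_iota /= !add0n => kd ld.
  by rewrite /wact !acts_incr !size_map !size_nseq kd ld !orbT !add0n => -[->].
move=> _ /mapP[k + ->]; rewrite mem_iota /= add0n => kd y.
rewrite /wact acts_incr size_map size_nseq kd orbT add0n => -[<-].
(* The complementary power completes T_1^k to the top power T_1^(d-1). *)
exists (nseq (d.-1 - k) ord0); rewrite acts_incr size_map size_nseq.
by rewrite subnKC ?ifT //; lia.
Qed.

End OneGenerator.

(** * The action on sequences by swapping ascents *)

(** On permutations this is right multiplication in the nilCoxeter algebra: the swap survives only
    if it increases the length. Positions beyond the end give [None]. *)
Fixpoint bub (i : nat) (s : seq nat) : option (seq nat) :=
  match i, s with
  | 0, x :: y :: s' => if (x < y)%N then Some (y :: x :: s') else None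
  | i'.+1, x :: s' => omap (cons x) (bub i' s')
  | _, _ => None
  end.

Lemma acts_bubS x s w :
  acts bub (x :: s) (map S w) = omap (cons x) (acts bub s w).
Proof. by elim: w s => //= i w IH s; case: (bub i s) => /=. Qed.

(** A swap leaves a descent, so every square acts by zero, which covers all d at least 2. Both sides
    of the braid relation reverse a strictly increasing triple and kill any other. *)
Lemma bub_NCA_action n d : (1 < d)%N -> NCA_action bub n d.
Proof.
have sq i s : acts bub s [:: i; i] = None.
  elim: i s => [|i IH] [|x s] //.
    by case: s => [|y s] //=; case: ltngtP => //= xy; rewrite ltnNge ltnW.
  by rewrite (acts_bubS x s [:: i; i]) IH.
move=> d_gt1; split=> // [i s _ | i j s ij _ | i s _].
- elim: i s => [|i IH] [|x s] //; last first.
    by have := acts_bubS x s; move=> /[dup] /(_ [:: i; i.+1; i]) /= ->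
      /(_ [:: i.+1; i; i.+1]) /= ->; have /= -> := IH s.
  case: s => [|y [|z s]] //=; first by case: ifP.
  case: (ltnP x y) => xy; case: (ltnP y z) => yz //=.
  + have xz := ltn_trans xy yz.
    by rewrite xz /= yz xy.
  + by case: (ltnP x z) => //= xz; rewrite ltnNge yz.
  + by case: (ltnP x z) => //= xz; rewrite ltnNge xy.
- elim: i j s ij => [|i IH] [|[|j]] [|x s] //.
    case: s => [|y s] //= _; case: (ltnP x y) => xy /=;
      by case: (bub j s) => /= [z|] //; rewrite ?xy ?ltnNge ?xy.
  move=> ij; have := acts_bubS x s.
  move=> /[dup] /(_ [:: i; j.+1]) /= -> /(_ [:: j.+1; i]) /= ->.
  by have /= -> := IH j.+1 s ij.
- case: d d_gt1 => [|[|d]] // _.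
  by have := acts_cat bub s [:: i; i] (nseq d i); rewrite sq.
Qed.

Lemma bub_inj : injective_action bub.
Proof.
elim=> [|i IH] [|x s] [|x' s'] z //= E1 E2 //; move: E1 E2.
- case: s => [|y s] //; case: s' => [|y' s'] //.
  by do 2!case: ifP => // _; move=> [<-] [-> -> ->].
- case Es: (bub i s) => [z1|] //= [<-]; case Es': (bub i s') => [z2|] //=.
  by move=> [-> E]; rewrite E in Es'; rewrite (IH _ _ _ Es Es').
Qed.

Lemma bub_perm i s s' : bub i s = Some s' -> perm_eq s' s.
Proof.
elim: i s s' => [|i IH] [|x s] s' //=.
  case: s => [|y s] //; case: ifP => // _ [<-].
  by rewrite (perm_catCA [:: y] [:: x]).
by case E: (bub i s) => [z|] //= [<-]; rewrite perm_cons; apply: IH.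
Qed.

Lemma acts_bub_perm s w s' : acts bub s w = Some s' -> perm_eq s' s.
Proof.
elim: w s => [s [->] // | i w IH s /=].
by case E: (bub i s) => [z|] //= /IH /perm_trans; apply; apply: bub_perm E.
Qed.

Lemma bub_catr i s c :
  (i.+1 < size s)%N -> bub i (s ++ c) = omap (cat^~ c) (bub i s).
Proof.
elim: i s => [|i IH] [|x s] //=.
  by case: s => //= y s _; case: ifP.
by rewrite ltnS => /IH->; case: (bub i s).
Qed.

Lemma acts_bub_catr s c w : all (fun i => i.+1 < size s)%N w ->
  acts bub (s ++ c) w = omap (cat^~ c) (acts bub s w).
Proof.
elim: w s => //= i w IH s /andP[isz wsz]; rewrite bub_catr //.
case E: (bub i s) => [z|] //=; apply: IH.
by rewrite (perm_size (bub_perm E)).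
Qed.

Lemma bub_catl a s : bub (size a) (a ++ s) = omap (cat a) (bub 0 s).
Proof.
elim: a => [|x a IH] /=; first by case: s => [|x [|y s]] //=; case: ifP.
by rewrite IH; case: s {IH} => [|y [|z s]] //=; case: ifP.
Qed.

(** * Descending runs and normal forms *)

Definition run (l m : nat) : seq nat := rev (iota l m).

Lemma runS l m : run l m.+1 = (l + m)%N :: run l m.
Proof. by rewrite /run -addn1 iotaD rev_cat. Qed.

Lemma runSr l m : run l m.+1 = run l.+1 m ++ [:: l].
Proof. by rewrite /run /= rev_cons cats1. Qed.

Lemma runD l m1 m2 : run l (m1 + m2) = run (l + m1) m2 ++ run l m1.
Proof. by rewrite /run iotaD rev_cat. Qed.

Lemma mem_run l m i : (i \in run l m) = (l <= i < l + m)%N.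
Proof. by rewrite mem_rev mem_iota. Qed.

(** Each letter of the run swaps [x] with its left neighbour, so the run carries [x] to the front of
    the block [b]. *)
Lemma acts_run a b x c : all (fun y => y < x)%N b ->
  acts bub (a ++ b ++ x :: c) (run (size a) (size b)) =
  Some (a ++ x :: b ++ c).
Proof.
elim/last_ind: b c => [|b y IH] c //.
rewrite all_rcons => /andP[yx bx]; rewrite size_rcons runS -size_cat.
rewrite -cats1 -catA /= [a ++ b ++ _]catA bub_catl /= yx /= -catA.
by rewrite IH // cats1 cat_rcons.
Qed.

(** The standard reduced words for the (k+1)! permutations of k+1 points: the j-th factor is a run
    from j-1 down to some [l], empty when l = j. *)
Fixpoint nfs (k : nat) : seq (seq nat) :=
  if k is k'.+1 then
    [seq u ++ run l (k - l) | u <- nfs k', l <- iota 0 k.+1]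
  else [:: [::]].

Lemma nfsP k u : reflect (exists u1 l, [/\ u1 \in nfs k, (l <= k.+1)%N &
  u = u1 ++ run l (k.+1 - l)]) (u \in nfs k.+1).
Proof.
apply: (iffP allpairsP) => [[[u1 l] [Hu1 Hl ->]] | [u1 [l [Hu1 Hl ->]]]].
  by exists u1, l; split=> //; move: Hl; rewrite mem_iota.
by exists (u1, l); split=> //; rewrite mem_iota.
Qed.

Lemma nfs_letters k u : u \in nfs k -> all (fun i => i < k)%N u.
Proof.
elim: k u => [|k IH] u; first by rewrite inE => /eqP->.
move=> /nfsP[u1 [l [/IH Hu1 Hl ->]]]; rewrite all_cat; apply/andP; split.
  by apply: sub_all Hu1 => i; lia.
by apply/allP => i; rewrite mem_run; lia.
Qed.

(** The word [u] leaves the last and largest entry in place; the run then inserts it at position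
    [l]. *)
Lemma acts_nf k u s l : u \in nfs k -> (l <= k.+1)%N ->
  acts bub (iota 0 k.+1) u = Some s ->
  acts bub (iota 0 k.+2) (u ++ run l (k.+1 - l)) =
  Some (take l s ++ k.+1 :: drop l s).
Proof.
move=> uk lk us; have sP := acts_bub_perm us.
have ssz : size s = k.+1 by rewrite (perm_size sP) size_iota.
rewrite -(addn1 k.+1) iotaD acts_cat acts_bub_catr; last first.
  by rewrite size_iota; apply: sub_all (nfs_letters uk) => i; lia.
rewrite us /= add0n -{1}(cat_take_drop l s) -catA.
have ls : (l <= size s)%N by rewrite ssz.
rewrite -ssz -size_drop; have := @acts_run (take l s) (drop l s) (size s) [::].
rewrite (size_takel ls) cats0; apply; apply/allP => i /mem_drop.
by rewrite (perm_mem sP) mem_iota ssz.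
Qed.

Lemma nfs_acts k u : u \in nfs k -> acts bub (iota 0 k.+1) u != None.
Proof.
elim: k u => [|k IH] u; first by rewrite inE => /eqP->.
move=> /nfsP[u1 [l [Hu1 Hl ->]]]; have := IH _ Hu1.
by case E: (acts _ _ u1) => [s|] // _; rewrite (acts_nf Hu1 Hl E).
Qed.

(** The position of the largest entry recovers the last run, and deleting that entry reduces to the
    previous stage. *)
Lemma nfs_inj k : {in nfs k &, injective (acts bub (iota 0 k.+1))}.
Proof.
elim: k => [|k IH] u v; first by rewrite !inE => /eqP-> /eqP->.
move=> /nfsP[u1 [l [Hu1 Hl ->]]] /nfsP[v1 [r [Hv1 Hr ->]]].
have := nfs_acts Hu1; case Eu: (acts _ _ u1) => [s|] // _.
have := nfs_acts Hv1; case Ev: (acts _ _ v1) => [z|] // _.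
rewrite (acts_nf Hu1 Hl Eu) (acts_nf Hv1 Hr Ev) => -[E].
have idx y h w : acts bub (iota 0 k.+1) w = Some y -> (h <= k.+1)%N ->
    index k.+1 (take h y ++ k.+1 :: drop h y) = h.
  move=> /acts_bub_perm yP hk; rewrite index_cat.
  rewrite size_takel ?(perm_size yP) ?size_iota //= eqxx addn0 ifN //.
  by apply/negP => /mem_take; rewrite (perm_mem yP) mem_iota; lia.
have lr : l = r by rewrite -(idx _ _ _ Eu Hl) E (idx _ _ _ Ev Hr).
rewrite -lr in E *; congr (_ ++ _); apply: IH => //; rewrite Eu Ev.
have sz : size (take l s) = size (take l z).
  rewrite !size_take (perm_size (acts_bub_perm Eu)).
  by rewrite (perm_size (acts_bub_perm Ev)).
move/eqP: E; rewrite eqseq_cat // => /andP[/eqP E1 /eqP[E2]].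
by rewrite -(cat_take_drop l s) E1 E2 cat_take_drop.
Qed.

(** * Bubble sort *)

(** The sum of the entries multiplied by their positions; moving the larger entry of an ascent to
    the left lowers it, so sorting terminates. *)
Fixpoint weight (s : seq nat) : nat :=
  if s is x :: s' then (weight s' + sumn s')%N else 0.

Lemma bub_weight i s s' : bub i s = Some s' -> (weight s' < weight s)%N.
Proof.
elim: i s s' => [|i IH] [|x s] s' //=.
  by case: s => [|y s] //=; case: ifP => // xy [<-] /=; lia.
case E: (bub i s) => [z|] //= [<-] /=.
have := IH _ _ E; have := perm_sumn (bub_perm E); lia.
Qed.

Lemma bub_stuck s : (forall i, (i.+1 < size s)%N -> bub i s = None) ->
  sorted geq s.
Proof.
elim: s => [|x [|y s] IH] //= H; apply/andP; split.
  by have := H 0%N isT; rewrite /=; case: ltnP.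
apply: IH => i isz; have /= := H i.+1 isz.
by case: (bub i _).
Qed.

Lemma bub_sort s : exists w s', [/\ all (fun i => i.+1 < size s)%N w,
  acts bub s w = Some s' & sorted geq s'].
Proof.
have [h] := ubnP (weight s); elim: h s => // h IH s sh.
have [|] := boolP [exists i : 'I_(size s), (i.+1 < size s)%N && (bub i s != None)].
  move=> /existsP[i /andP[isz]]; case E: (bub i s) => [z|] // _.
  have [] := IH z; first by have := bub_weight E; lia.
  move=> w [s' []]; rewrite (perm_size (bub_perm E)) => wsz ws' ss'.
  by exists (val i :: w), s'; split; rewrite /= ?isz // E.
move=> /existsPn H; exists [::], s; split=> //; apply: bub_stuck => i isz.
have /= := H (Ordinal (ltnW isz)); rewrite isz /= negbK.
by move/eqP.
Qed.

(** * Word calculus in the algebra, and the case d = 2 *)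

Section NatWords.
Variables (F : fieldType) (m d : nat).
Local Notation n := m.+1.

(** Natural letters allow index arithmetic. Since [inord] sends letters out of range to 0, bounds
    are assumed wherever the letter itself matters. *)
Definition natw (u : seq nat) : word n := map inord u.

Lemma natw_cat u v : natw (u ++ v) = natw u ++ natw v.
Proof. exact: map_cat. Qed.

Lemma val_natw u : all (fun i => i < n)%N u -> map val (natw u) = u.
Proof.
move=> /allP un; rewrite -map_comp -[RHS]map_id; apply/eq_in_map => i /un.
exact: inordK.
Qed.

Definition zeronw u := zerow F d (natw u).
Definition eqnw u v := eqw F d (natw u) (natw v).

Lemma eqnw_refl u : eqnw u u. Proof. exact: eqw_refl. Qed.
Lemma eqnw_sym u v : eqnw u v -> eqnw v u. Proof. exact: eqw_sym. Qed.
Lemma eqnw_trans v u w : eqnw u v -> eqnw v w -> eqnw u w.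
Proof. exact: eqw_trans. Qed.
Lemma zeronw_eqnw u v : eqnw u v -> zeronw v -> zeronw u.
Proof. exact: zerow_eqw. Qed.

Lemma zeronw_cat a b u : zeronw u -> zeronw (a ++ u ++ b).
Proof. by rewrite /zeronw !natw_cat; apply: zerow_cat. Qed.

Lemma eqnw_cat a b u v : eqnw u v -> eqnw (a ++ u ++ b) (a ++ v ++ b).
Proof. by rewrite /eqnw !natw_cat; apply: eqw_cat. Qed.

Lemma eqnw_catl a u v : eqnw u v -> eqnw (a ++ u) (a ++ v).
Proof. by move/(eqnw_cat a [::]); rewrite !cats0. Qed.

Lemma eqnw_catr b u v : eqnw u v -> eqnw (u ++ b) (v ++ b).
Proof. exact: (@eqnw_cat [::]). Qed.

Lemma eqnw_braid i : (i.+1 < n)%N -> eqnw [:: i; i.+1; i] [:: i.+1; i; i.+1].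
Proof.
move=> ilt; apply: (@ideal_ext _ _ _
  [:: (1, [:: inord i; inord i.+1; inord i]);
      (-1, [:: inord i.+1; inord i; inord i.+1])]).
  by move=> g; rewrite ncevB !ncev_word !ncev_cons ncev_nil mul1r mulN1r addr0.
apply: NCA_rel_ideal; exists (inord i), (inord i.+1); constructor 1.
by rewrite !val_insubd ilt (ltnW ilt).
Qed.

Lemma eqnw_comm i j : (i.+1 < j < n)%N -> eqnw [:: i; j] [:: j; i].
Proof.
move=> /andP[ij jn]; apply: (@ideal_ext _ _ _
  [:: (1, [:: inord i; inord j]); (-1, [:: inord j; inord i])]).
  by move=> g; rewrite ncevB !ncev_word !ncev_cons ncev_nil mul1r mulN1r addr0.
apply: NCA_rel_ideal; exists (inord i), (inord j); constructor 2.
rewrite !val_insubd jn ifT //; lia.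
Qed.

Lemma zeronw_square i : (i.+1 < n)%N -> zeronw [:: i; i].
Proof.
move=> ilt; apply: NCA_rel_ideal; exists (inord i), (inord i); constructor 3.
by rewrite val_insubd (ltnW ilt).
Qed.

Lemma zeronw_square_max : d = 2 -> zeronw [:: m; m].
Proof.
move=> d2; apply: NCA_rel_ideal; exists (inord m), (inord m); constructor 4.
by rewrite val_insubd ltnSn d2.
Qed.

Lemma eqnw_comm_above i w : all (fun j => (i.+1 < j < n)%N) w ->
  eqnw (w ++ [:: i]) (i :: w).
Proof.
elim: w => [_|j w IH /= /andP[ij iw]]; first exact: eqnw_refl.
apply: eqnw_trans (eqnw_catl [:: j] (IH iw)) _.
by apply: (@eqnw_catr w [:: j; i] [:: i; j]); apply/eqnw_sym/eqnw_comm.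
Qed.

Lemma eqnw_comm_below j w : (j < n)%N -> all (fun i => i.+1 < j)%N w ->
  eqnw (w ++ [:: j]) (j :: w).
Proof.
move=> jn; elim: w => [_|i w IH /= /andP[ij iw]]; first exact: eqnw_refl.
apply: eqnw_trans (eqnw_catl [:: i] (IH iw)) _.
by apply: (@eqnw_catr w [:: i; j] [:: j; i]); apply: eqnw_comm; rewrite ij.
Qed.

(** Move [i.+1] left past the letters below [i], apply the braid relation, then move the leading [i]
    left past the letters above [i.+1]. *)
Lemma eqnw_run_slide l k i : (l <= i)%N -> (i.+1 < l + k <= n)%N ->
  eqnw (run l k ++ [:: i.+1]) (i :: run l k).
Proof.
move=> li /andP[ik kn].
pose hi := run i.+2 (l + k - i.+2); pose lo := run l (i - l).
have -> : run l k = hi ++ [:: i.+1; i] ++ lo.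
  have -> : k = ((i - l) + (l + k - i.+2).+2)%N by lia.
  by rewrite runD subnKC // !runSr -!catA.
apply: (@eqnw_trans (hi ++ [:: i.+1; i; i.+1] ++ lo)).
  rewrite -!catA; apply: eqnw_catl.
  apply: (@eqnw_catl [:: i.+1; i] (lo ++ [:: i.+1]) (i.+1 :: lo)).
  apply: eqnw_comm_below; first by lia.
  by apply/allP => j; rewrite mem_run; lia.
apply: (@eqnw_trans (hi ++ [:: i; i.+1; i] ++ lo)).
  by apply: eqnw_cat; apply/eqnw_sym/eqnw_braid; lia.
rewrite -(cat1s i (_ ++ _)) (catA hi [:: i]) catA.
apply: (@eqnw_catr ([:: i.+1; i] ++ lo) (hi ++ [:: i]) (i :: hi)).
by apply: eqnw_comm_above; apply/allP => j; rewrite mem_run; lia.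
Qed.

(** Compare [i] with the end [l] of the last run. If i = l a square appears; if i+1 = l the run
    grows; a smaller letter commutes through the run; a larger one slides through and drops by one.
    In the last two cases induction applies to the earlier runs. *)
Lemma nfs_mulr k u i : (k <= n)%N -> (k < n)%N \/ d = 2 ->
  u \in nfs k -> (i < k)%N ->
  zeronw (u ++ [:: i]) \/ exists2 v, v \in nfs k & eqnw (u ++ [:: i]) v.
Proof.
move=> + kd; have sq j : (j < k)%N -> (j < n)%N -> zeronw [:: j; j].
  move=> jk jn; have [jm|jm] := ltnP j m; first exact: zeronw_square.
  have -> : j = m by lia.
  by case: kd => [|d2]; [lia | apply: zeronw_square_max].
move: sq {kd}; elim: k u i => // k IH u i sq kn /nfsP[u1 [l [Hu1 Hl ->]]] ik.
have IHu j : (j < k)%N ->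
    eqnw (run l (k.+1 - l) ++ [:: i]) (j :: run l (k.+1 - l)) ->
    zeronw ((u1 ++ run l (k.+1 - l)) ++ [:: i]) \/
    exists2 v, v \in nfs k.+1 & eqnw ((u1 ++ run l (k.+1 - l)) ++ [:: i]) v.
  move=> jk /(eqnw_catl u1); rewrite catA (catA u1 [:: j]) => E.
  have sqk h : (h < k)%N -> (h < n)%N -> zeronw [:: h; h].
    by move=> hk; apply: sq; lia.
  have [z|[v Hv vE]] := IH u1 j sqk (ltnW kn) Hu1 jk.
    by left; apply: zeronw_eqnw E _; apply: (@zeronw_cat [::]).
  right; exists (v ++ run l (k.+1 - l)); first by apply/nfsP; exists v, l.
  by apply: eqnw_trans E _; apply: eqnw_catr.
have [il|li|il] := ltngtP i l.
- have [il1|il1] := eqVneq i.+1 l.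
    right; exists (u1 ++ run i (k.+1 - i)).
      by apply/nfsP; exists u1, i; split=> //; lia.
    have -> : (k.+1 - i = (k.+1 - l).+1)%N by lia.
    by rewrite runSr il1 -catA; apply: eqnw_refl.
  apply: (IHu i); first by lia.
  by apply: eqnw_comm_above; apply/allP => j; rewrite mem_run; lia.
- case: i ik li IHu => // i ik li IHu; apply: (IHu i); first by lia.
  by apply: eqnw_run_slide; lia.
left; have -> : (k.+1 - l = (k - l).+1)%N by lia.
rewrite runSr il -!catA /= catA -[_ ++ _]cats0 -catA.
by apply: zeronw_cat; apply: sq; lia.
Qed.

Lemma nfs_span (u : word n) : d = 2 ->
  zerow F d u \/ exists2 b, b \in [seq natw v | v <- nfs n] & eqw F d u b.
Proof.
move=> d2; elim/last_ind: u => [|u i [zu|[_ /mapP[v Hv ->] uv]]].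
- right; exists [::]; last exact: eqw_refl.
  apply/mapP; exists [::] => //; elim: {1}n => // k IH.
  by apply/nfsP; exists [::], k.+1; rewrite subnn.
- by left; rewrite -cats1; apply: (@zerow_cat _ _ _ [::] [:: i]).
have iE : [:: i] = natw [:: val i] by rewrite /natw /= inord_val.
have E : eqw F d (rcons u i) (natw (v ++ [:: val i])).
  by rewrite natw_cat -iE -cats1; apply: (eqw_cat [::] [:: i]).
have [z|[w Hw vw]] := nfs_mulr (leqnn n) (or_intror d2) Hv (ltn_ord i).
  by left; apply: zerow_eqw E z.
by right; exists (natw w); [apply: map_f | apply: eqw_trans E vw].
Qed.

Lemma wact_natw (X : eqType) (t : nat -> X -> option X) x u :
  all (fun i => i < n)%N u -> wact t x (natw u) = acts t x u.
Proof. by move=> un; rewrite /wact val_natw. Qed.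

Lemma NCA_2_Frobenius : d = 2 -> NCA_Frobenius F n d.
Proof.
move=> d2.
have bE u : u \in nfs n -> wact bub (iota 0 n.+1) (natw u) = acts bub (iota 0 n.+1) u.
  by move=> /nfs_letters; apply: wact_natw.
have tP : NCA_action bub n d by apply: bub_NCA_action; rewrite d2.
apply: (action_Frobenius (x0 := iota 0 n.+1) (top := rev (iota 0 n.+1))
          (B := [seq natw v | v <- nfs n]) tP).
- exact: bub_inj.
- by move=> u; apply: nfs_span.
- by move=> _ /mapP[u Hu ->]; rewrite bE //; apply: nfs_acts.
- move=> _ _ /mapP[u Hu ->] /mapP[v Hv ->]; rewrite !bE // => E.
  by congr natw; apply: nfs_inj E.
move=> _ /mapP[u Hu ->] s; rewrite bE // => us.
have sP := acts_bub_perm us.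
have [w [s' [ws ws' ss']]] := bub_sort s.
exists (natw w); rewrite wact_natw; last first.
  by move: ws; rewrite (perm_size sP) size_iota.
(* A nonincreasing rearrangement is unique, so sorting ends at the reversed sequence. *)
rewrite ws'; congr Some; apply: (sorted_eq (leT := geq)) => //.
- by move=> x y z; rewrite /geq /=; lia.
- by move=> x y; rewrite /geq /=; lia.
- by rewrite rev_sorted; apply: sub_sorted (iota_ltn_sorted _ _) => x y /ltnW.
rewrite (perm_trans (acts_bub_perm ws')) // (perm_trans sP) //.
by rewrite perm_sym perm_rev.
Qed.

End NatWords.

(** * Socle elements in a Frobenius algebra *)

(* A word killed by every generator on the right pairs trivially with all
   nonempty words, so it is determined by its pairing with the empty word. *)
Lemma Frobenius_socle (F : fieldType) n d (z1 z2 : word n) :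
  NCA_Frobenius F n d ->
  (forall i, zerow F d (z1 ++ [:: i])) -> (forall i, zerow F d (z2 ++ [:: i])) ->
  zerow F d z2 \/ exists2 a : F, a != 0 & exists b : F,
    NCA_ideal d (ncsub (ncscale a (ncword F z1)) (ncscale b (ncword F z2))).
Proof.
move=> [_ [sigma [van assoc left _]]] k1 k2.
(* By associativity the generator can be moved to the left argument, where it kills [z]. *)
have s0 z i u : (forall i, zerow F d (z ++ [:: i])) -> sigma z (i :: u) = 0.
  move=> kz; have [+ _] := van _ (ncword F u) (kz i).
  rewrite !ncform_ncev !ncev_word => <-.
  have := assoc (ncword F z) (ncword F [:: i]) (ncword F u).
  by rewrite !ncform_ncev ncevM !ncev_word ncevM !ncev_word.
have [e2|n2] := eqVneq (sigma z2 [::]) 0; [left | right].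
  apply: left => q; rewrite ncform_ncev ncev_word /ncev big1 // => -[c u] _ /=.
  by case: u => [|i u]; rewrite ?e2 ?s0 // mulr0.
(* These coefficients make the combination pair to zero with the empty word as well. *)
exists (sigma z2 [::]) => //; exists (sigma z1 [::]); apply: left => q.
rewrite ncform_ncev ncevB !ncevZ !ncev_word /ncev !mulr_sumr -sumrB.
rewrite big1 // => -[c [|i u]] _ /=; last by rewrite !s0 // !mulr0 subrr.
by rewrite ![c * _]mulrC !mulrA [sigma z1 _ * _]mulrC subrr.
Qed.

(** The normal form with all runs of full length, a reduced word of the longest element on the
    letters below [k]. *)
Fixpoint stair (k : nat) : seq nat :=
  if k is k'.+1 then stair k' ++ run 0 k else [::].

Lemma stair_nfs k : stair k \in nfs k.
Proof.
by elim: k => // k IH; apply/nfsP; exists (stair k), 0%N; rewrite subn0.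
Qed.

(** Sliding through the successive runs lowers the letter to 0, where it meets a run ending in 0.
    Since [0 < m], this letter is not the last generator and its square vanishes for every [d]. *)
Lemma stair_mulr F m d k i : (0 < m)%N -> (k <= m.+1)%N -> (i < k)%N ->
  zeronw F m d (stair k ++ [:: i]).
Proof.
move=> m0; elim: k i => // k IH [|i] km ik.
  rewrite [stair _]/= runSr -!catA catA -[_ ++ _]cats0 -catA.
  by apply: zeronw_cat; apply: zeronw_square.
rewrite [stair _]/= -catA.
apply: zeronw_eqnw (eqnw_catl _ (@eqnw_run_slide F m d 0 k.+1 i _ _)) _ => //; first lia.
rewrite -cat1s catA; apply: (@zeronw_cat F m d [::]); apply: IH; lia.
Qed.

(** * An action that detects T_n^2 *)

Section LevelAction.
Variables (m : nat).

(* With n = m + 2, a model of the right module generated by T_n^2: the level counts the T_n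
   used so far, and T_(n-1) acts only once the level 2 is reached. *)
Definition lev (i : nat) (x : nat * seq nat) : option (nat * seq nat) :=
  if i == m.+1 then if (x.1 < 2)%N then Some (x.1.+1, x.2) else None
  else if (i == m) && (x.1 != 2) then None else omap (pair x.1) (bub i x.2).

(** The boolean summand admits the letter [m] exactly at level 2. *)
Lemma acts_lev j s w : all (fun i => i < m + (j == 2))%N w ->
  acts lev (j, s) w = omap (pair j) (acts bub s w).
Proof.
elim: w s => //= i w IH s /andP[im wm].
rewrite /lev /= ifN ?ifN; try by case: eqP im => //=; lia.
by case: (bub i s) => //= z; apply: IH.
Qed.

(** Both sides of the braid relation for the last two generators act by zero: [m] acts only at level
    2, where [m.+1] kills. Three uses of [m.+1] exceed the levels, whence [2 < d]. *)
Lemma lev_NCA_action d : (2 < d)%N -> NCA_action lev m.+2 d.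
Proof.
move=> d2; have [braid comm sq _] := @bub_NCA_action m.+2 2 isT.
have levM j s : lev m.+1 (j, s) = if (j < 2)%N then Some (j.+1, s) else None.
  by rewrite /lev eqxx.
have levm j s : lev m (j, s) = if j == 2 then omap (pair j) (bub m s) else None.
  by rewrite /lev eqxx ifN /=; [case: eqP | lia].
have levi i j s : (i < m)%N -> lev i (j, s) = omap (pair j) (bub i s).
  by move=> im; rewrite /lev ifN ?ifN //=; case: eqP; lia.
split.
- move=> i [j s] im; have [im'|im'] := leqP m i.
    have -> : i = m by lia.
    rewrite /= levM levm; case: eqP => [->|] /=.
      by case: (bub m s) => [z|] //=; rewrite levM.
    case: j => [|[|j]] //= _; rewrite levm //=.
    by case: (bub m s) => [z|] //=; rewrite levM.
  have [j2|j2] := eqVneq j 2.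
    by rewrite !acts_lev ?braid // j2 /=; lia.
  have [im2|im2] := ltnP i.+1 m.
    by rewrite !acts_lev ?braid //= (negPf j2) /=; lia.
  have e : i.+1 = m by lia.
  rewrite e /= levm (negPf j2) levi //=.
  by case: (bub i s) => [z|] //=; rewrite levm (negPf j2).
- move=> i j [k s] ij jm; have im : (i < m)%N by lia.
  have [jm'|jm'] := ltnP j m.+1; last first.
    have -> : j = m.+1 by lia.
    rewrite /= levM levi //; case: (ltnP k 2) => k2 /=.
      by rewrite levi //; case: (bub i s) => [z|] //=; rewrite levM k2.
    by case: (bub i s) => [z|] //=; rewrite levM ltnNge k2.
  have [k2|k2] := eqVneq k 2.
    by rewrite !acts_lev ?(comm i j) // k2 /=; lia.
  have [jm2|jm2] := ltnP j m.
    by rewrite !acts_lev ?(comm i j) //= (negPf k2) /=; lia.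
  have -> : j = m by lia.
  rewrite /= levm (negPf k2) levi //=.
  by case: (bub i s) => [z|] //=; rewrite levm (negPf k2).
- move=> i [j s] im; have [j2|j2] := eqVneq j 2.
    by rewrite !acts_lev ?sq // j2 /=; lia.
  have [im2|im2] := ltnP i m.
    by rewrite !acts_lev ?sq //= (negPf j2) /=; lia.
  by have -> : i = m; [lia | rewrite /= levm (negPf j2)].
- move=> i [j s] [->]; case: d d2 => [|[|[|d']]] // _ /=; rewrite levM.
  by case: j => [|[|j]] //=; rewrite !levM //= levM.
Qed.
End LevelAction.

(** * Two independent socle elements for n at least 2 and d at least 3 *)

Section TwoSocles.
Variables (F : fieldType) (m d : nat).
Hypothesis d_gt2 : (2 < d)%N.

Let z2 : seq nat := stair m ++ [:: m.+1; m.+1] ++ run 0 m.+1.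

(** The letter 0 creates a square at the end. A letter from 1 to [m] slides through the run,
    commutes with T_n^2 and is absorbed by [stair m]. The letter [m.+1] yields the square of [m]
    after two braid moves. *)
Let z2_mulr i : (i < m.+2)%N -> zeronw F m.+1 d (z2 ++ [:: i]).
Proof.
rewrite /z2 -!catA; case: i => [|i] im.
  have -> : stair m ++ [:: m.+1; m.+1] ++ run 0 m.+1 ++ [:: 0%N] =
      (stair m ++ [:: m.+1; m.+1] ++ run 1 m) ++ [:: 0; 0]%N ++ [::].
    by rewrite runSr -!catA.
  by apply: zeronw_cat; apply: zeronw_square.
have [im'|im'] := ltnP i m.
  apply: (@zeronw_eqnw _ _ _ _ (stair m ++ [:: m.+1; m.+1] ++ i :: run 0 m.+1)).
    by do 2!apply: eqnw_catl; apply: eqnw_run_slide; lia.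
  apply: (@zeronw_eqnw _ _ _ _ (stair m ++ (i :: [:: m.+1; m.+1]) ++ run 0 m.+1)).
    apply: eqnw_cat (run 0 m.+1) ([:: m.+1; m.+1] ++ [:: i]) _ _.
    by apply: eqnw_comm_above => /=; lia.
  rewrite -[i :: _]cat1s -catA catA.
  by apply: (@zeronw_cat _ _ _ [::]); apply: stair_mulr; lia.
have -> : i = m by lia.
rewrite runS add0n.
apply: (@zeronw_eqnw _ _ _ _ (stair m ++ [:: m.+1; m.+1; m; m.+1] ++ run 0 m)).
  apply: eqnw_catl; apply: (@eqnw_catl _ _ _ [:: m.+1; m.+1; m]).
  apply: eqnw_comm_below => //; apply/allP => j; rewrite mem_run; lia.
apply: zeronw_cat.
apply: (@zeronw_eqnw _ _ _ _ [:: m.+1; m; m.+1; m]).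
  by apply: (@eqnw_catl _ _ _ [:: m.+1]); apply/eqnw_sym/eqnw_braid.
apply: (@zeronw_eqnw _ _ _ _ [:: m; m.+1; m; m]).
  apply: (@eqnw_catr _ _ _ [:: m] [:: m.+1; m; m.+1] [:: m; m.+1; m]).
  by apply/eqnw_sym/eqnw_braid.
by apply: (@zeronw_cat _ _ _ [:: m; m.+1] [::] [:: m; m]); apply: zeronw_square.
Qed.

Let z2_letters : all (fun i => i < m.+2)%N z2.
Proof.
rewrite /z2 !all_cat /= ltnSn /=; apply/andP; split.
  by apply: sub_all (nfs_letters (stair_nfs m)) => i; lia.
by apply/allP => i; rewrite mem_run; lia.
Qed.

(** The two letters [m.+1] only raise the level to 2; the rest of [z2] spells [stair m.+1], which
    acts on the sequence without vanishing. *)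
Let z2_lev : acts (lev m) (0, iota 0 m.+2)%N z2 != None.
Proof.
have := nfs_acts (stair_nfs m.+1); rewrite /z2 [stair m.+1]/= !acts_cat.
rewrite acts_lev; last by rewrite addn0; apply: nfs_letters (stair_nfs m).
case: (acts bub _ _) => [s|] //=; rewrite /lev eqxx /= -/lev.
have := @acts_lev m 2 s (run 0 m.+1).
case: (acts bub s _) => [r|] //= -> //.
by apply/allP => i; rewrite mem_run; lia.
Qed.

Lemma NCA_not_Frobenius : ~ NCA_Frobenius F m.+2 d.
Proof.
move=> frob.
have kill w : (forall i, (i < m.+2)%N -> zeronw F m.+1 d (w ++ [:: i])) ->
    forall i, zerow F d (natw m.+1 w ++ [:: i]).
  move=> kw i; have := kw i (ltn_ord i).
  by rewrite /zeronw natw_cat {2}/natw /= inord_val.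
have d_gt1 := ltnW d_gt2.
pose z1 := stair m.+2.
have [||z|] := @Frobenius_socle F m.+2 d (natw m.+1 z1) (natw m.+1 z2) frob.
- by apply: kill => i im; apply: stair_mulr.
- exact: kill.
- move: z2_lev; rewrite -(@wact_natw m.+1) //.
  by rewrite (zerow_wact (lev_NCA_action m d_gt2) _ z).
move=> [a a0 [b]]; have := nfs_acts (stair_nfs m.+2).
case E: (acts bub _ _) => [y|] // _.
move=> /(action_ideal (bub_NCA_action m.+2 d_gt1) (iota 0 m.+3) y) /eqP.
rewrite ncevB !ncevZ !ncev_word !wact_natw //; last first.
  exact: nfs_letters (stair_nfs _).
rewrite E eqxx mulr1 /z2 acts_cat; case: (acts bub _ _) => [s|] /=.
  (* With one generator more, [m.+1] is not the last letter and its square law is available. Hence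
     [z2] acts by zero while [z1] does not, forcing a = 0. *)
  have [_ _ sq _] := @bub_NCA_action m.+3 2 isT.
  have := acts_cat bub s [:: m.+1; m.+1] (run 0 m.+1); rewrite sq //= => ->.
  by rewrite mulr0 subr0 (negPf a0).
by rewrite mulr0 subr0 (negPf a0).
Qed.

End TwoSocles.

(** * The equivalence, by cases on n and d *)

Unset Implicit Arguments.

Theorem theorem5p2 (F : fieldType) (n d : nat) :
  (1 <= n)%N -> (2 <= d)%N ->
  (NCA_Frobenius F n d <-> n = 1%N \/ d = 2%N).
Proof.
case: n => [|[|m]] // _ d2; first by split; [left | move=> _; apply: NCA_1_Frobenius].
split=> [frob | [//|dE]]; last exact: NCA_2_Frobenius.
by right; have [d3|] := ltnP 2 d; [case: (@NCA_not_Frobenius F m d) | lia].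
Qed.
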